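(* Let $\Delta>\delta\geq 0$ be integers and let $p(x)=a_{\Delta}x^{\Delta}+a_{\Delta-1}x^{\Delta-1}+\cdots+a_{\delta}x^{\delta}$ be a polynomial with non-negative integer coefficients such that $a_{\Delta}\geq 1$ and $a_{\delta}\geq 1$. Suppose that $p(1)=a_{\Delta}+\cdots+a_{\delta}=n$. If $z\in\mathbb{C}$ is a root of $p(x)$, then $$|z|\leq \max\left\{\frac{n-a_{\Delta}}{a_{\Delta}},\ \frac{a_{\Delta}}{n-a_{\Delta}}\right\}.$$ *)

(* Defs.v *)
From mathcomp Require Export all_boot all_order all_algebra.
From mathcomp Require Export reals complex.

(* Main.v *)
Require Import Defs.

Import Order.TTheory GRing.Theory Num.Theory.

Local Open Scope ring_scope.
Local Open Scope complex_scope.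

(** Write [A] for the leading coefficient and [B = n - A] for the sum of the
    other coefficients; both are positive, since [B] contains the term
    [a delta].  The right-hand side is the maximum of a positive
    number and its inverse, so it is at least [1] and only roots of modulus at
    least [1] matter ([max_div_ge1]).  For such a root [z], the leading term is
    minus the sum of the lower ones; since each lower power of [|z|] is at most
    [|z| ^ (Delta - 1)], this gives [A |z| ^ Delta <= B |z| ^ (Delta - 1)], that
    is [|z| <= B / A] ([lead_coef_mul_norm_root_le]). *)

(** The triangle inequality, with every lower power of [`|z|] replaced by the
    highest one; this replacement is where [1 <= `|z|] is needed. *)
Lemma lead_coef_mul_norm_root_le (C : numFieldType) (m d : nat) (b : nat -> C)
    (z : C) :
  (d <= m.+1)%N ->
  (forall i : nat, (d <= i <= m.+1)%N -> 0 <= b i) ->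
  \sum_(d <= i < m.+2) b i * z ^+ i = 0 ->
  1 <= `|z| ->
  b m.+1 * `|z| <= \sum_(d <= i < m.+1) b i.
Proof.
move=> ledm b_ge0 + z_ge1.
rewrite big_nat_recr //= => /eqP; rewrite addrC addr_eq0 => /eqP lead_eq.
have zm_gt0 : 0 < `|z| ^+ m by rewrite exprn_gt0 // (lt_le_trans ltr01).
rewrite -(ler_pM2r zm_gt0) -mulrA -exprS.
have <- : `|b m.+1 * z ^+ m.+1| = b m.+1 * `|z| ^+ m.+1.
  by rewrite normrM normrX ger0_norm // b_ge0 // ledm leqnn.
rewrite lead_eq normrN (le_trans (ler_norm_sum _ _ _)) // mulr_suml.
rewrite big_nat_cond [leRHS]big_nat_cond.
apply: ler_sum => i /andP[/andP[ledi ltim] _].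
have bi_ge0 : 0 <= b i by rewrite b_ge0 // ledi ltnW.
by rewrite normrM normrX ger0_norm // ler_wpM2l // ler_weXn2l.
Qed.

Lemma max_div_ge1 (F : realFieldType) (x y : F) :
  0 < x -> 0 < y -> 1 <= Num.max (x / y) (y / x).
Proof.
move=> x_gt0 y_gt0; rewrite le_max !ler_pdivlMr // !mul1r.
exact: le_total.
Qed.

Theorem proposition3p1 (R : realType) (Delta delta : nat) (a : nat -> int)
    (p : {poly int}) (n : int) (z : R[i]) :
  (delta < Delta)%N ->
  p = \sum_(delta <= i < Delta.+1) a i *: 'X^i ->
  (forall i : nat, (delta <= i <= Delta)%N -> 0 <= a i) ->
  1 <= a Delta ->
  1 <= a delta ->
  p.[1] = n ->
  root (map_poly (intr : int -> R[i]) p) z ->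
  `|z| <= (Num.max ((n - a Delta)%:~R / (a Delta)%:~R : R)
                   ((a Delta)%:~R / (n - a Delta)%:~R : R))%:C.
Proof.
case: Delta => // m ltdm -> a_ge0 lead_ge1 low_ge1 p1 rootz.
have sumE : n - a m.+1 = \sum_(delta <= i < m.+1) a i.
  rewrite -p1 horner_sum big_nat_recr ?(ltnW ltdm) //=.
  rewrite hornerZ hornerXn expr1n mulr1 addrK.
  by apply: eq_bigr => i _; rewrite hornerZ hornerXn expr1n mulr1.
have rest_gt0 : 0 < n - a m.+1.
  rewrite sumE big_ltn // ltr_pwDl // big_nat_cond.
  apply: sumr_ge0 => i /andP[/andP[ltdi ltim] _].
  by rewrite a_ge0 // (ltnW ltdi) (ltnW ltim).
have lead_gt0 : 0 < a m.+1 by [].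
have evalE : \sum_(delta <= i < m.+2) (a i)%:~R * z ^+ i = 0.
  move/rootP: rootz; rewrite rmorph_sum horner_sum; apply: etrans.
  by apply: eq_bigr => i _; rewrite /= map_polyZ map_polyXn hornerZ hornerXn.
have [z_le1 | /ltW z_ge1] := real_leP (normr_real z) (real1 _).
  apply: (le_trans z_le1); rewrite -[1]/(1%:C) lecR.
  by rewrite max_div_ge1 // ltr0z.
apply: (@le_trans _ _ ((n - a m.+1)%:~R / (a m.+1)%:~R : R)%:C); last first.
  by rewrite lecR le_max lexx.
rewrite fmorph_div !rmorph_int ler_pdivlMr ?ltr0z // mulrC sumE rmorph_sum.
apply: (@lead_coef_mul_norm_root_le _ _ _ (fun i => (a i)%:~R)) evalE z_ge1.
  exact: ltnW.
by move=> i /a_ge0; rewrite ler0z.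
Qed.
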